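(* Let $G$ be a set and $\alpha_G:G\to\mathbf N$ a function, and let $\mathcal{WO}_u^\theta$ be the category determined by $G$ and $\alpha_G$. For all arrow terms $u$ and $v$ of $\mathcal{WO}_u^\theta$ of the same type (same source and same target) we have $u=v$ in $\mathcal{WO}_u^\theta$.
   Context: **Words and nominal arities.** An $\mathbf N^+$-word is a finite (possibly empty) sequence of positive integers; $ab$ is the concatenation of $a$ and $b$. A nominal arity is a set of $\mathbf N^+$-words that contains no two distinct words of the form $a$ and $ab$. A word $a$ is a prefix of a nominal arity $X$ if $a$ is an initial segment (not necessarily proper) of every member of $X$. Put $a\cdot X=\{ab\mid b\in X\}$. If $a\in Y$ is a prefix of $X$, put $Y\triangleleft_a X=(Y\setminus\{a\})\cup X$, which is a nominal arity. For $n\ge 0$, $\bar n=\{1,\dots,n\}$ (one-letter words), $\bar 0=\emptyset$. **Terms of $\mathcal O_u$.** Defined inductively with a nominal arity $s(f)$ and a word $t(f)$ for each term $f$: (0) for $x\in G$ and a word $a$, $a\cdot x$ is a term, $s(a\cdot x)=a\cdot\overline{\alpha_G(x)}$ if $\alpha_G(x)\neq1$, $s(a\cdot x)=\{a\}$ if $\alpha_G(x)=1$, $t(a\cdot x)=a$; (1) for a word $a$, $a\cdot\mathbf I$ is a term, $s(a\cdot\mathbf I)=\{a\}$, $t(a\cdot\mathbf I)=a$; (2) if $f,g$ are terms and $t(f)\in s(g)$, then $g\triangleleft f$ is a term, $s(g\triangleleft f)=s(g)\triangleleft_{t(f)}s(f)$, $t(g\triangleleft f)=t(g)$. **Objects of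 $\mathcal{WO}_u^\theta$.** The normal terms of $\mathcal O_u$: those in which all parentheses are associated to the left and $\mathbf I$ does not occur, together with the terms $a\cdot\mathbf I$. They are written without $\triangleleft$ and parentheses, so that an object not of the form $a\cdot\mathbf I$ is a nonempty word in the letters $a\cdot x$ ($x\in G$). For objects $g,f$ with $t(f)\in s(g)$, $gf$ denotes the concatenation if neither is of the form $a\cdot\mathbf I$, while $g(a\cdot\mathbf I)=g$ for $a\in s(g)$ and $(t(f)\cdot\mathbf I)f=f$. An expression $hgf$ is read as $(hg)f$. **Arrow terms.** The basic arrow terms are $\mathbf 1_f:f\to f$ for every object $f$, and $\theta_{h,g,f}:hgf\to hfg$ for objects $h,g,f$ with $t(f)\in s(h)$ and $t(g)\in s(h)$ (the source $hgf$ and the target $hfg$ being both defined). Arrow terms are closed under composition ($v\circ u:f\to h$ for $u:f\to g$, $v:g\to h$) and the product: for $u:f\to f'$ and $v:g\to g'$ with $gf$ and $g'f'$ defined, $vu:gf\to g'f'$. **Equations.** The arrows are equivalence classes of arrow terms under the smallest equivalence relation $=$ between arrow terms of the same type that is a congruence for $\circ$ and the product, satisfies the category axioms (with identities $\mathbf 1_f$), is such that the product is strictly associative and strictly unital ($(wv)u=w(vu)$; $u\mathbf 1_{a\cdot\mathbf I}=u$ and $\mathbf 1_{t(f)\cdot\mathbf I}u=u$ for $u:f\to f'$, $a\in s(f)$), and contains all instances, with both sides well-formed, of: - $\mathbf 1_g\mathbf 1_f=\mathbf 1_{gf}$; $(v_2\circ v_1)(u_2\circ u_1)=(v_2u_2)\circ(v_1u_1)$;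 - for $u:f_1\to f_2$, $v:g_1\to g_2$, $w:h_1\to h_2$: $\theta_{h_2,g_2,f_2}\circ(wvu)=(wuv)\circ\theta_{h_1,g_1,f_1}$; - $\theta_{h,f,g}\circ\theta_{h,g,f}=\mathbf 1_{hgf}$; - $\theta_{jf,h,g}\circ(\theta_{j,h,f}\mathbf 1_g)\circ\theta_{jh,g,f}=(\theta_{j,g,f}\mathbf 1_h)\circ\theta_{jg,h,f}\circ(\theta_{j,h,g}\mathbf 1_f)$; - $\mathbf 1_j\theta_{h,g,f}=\theta_{jh,g,f}$; - $\theta_{j,hg,f}=(\theta_{j,h,f}\mathbf 1_g)\circ\theta_{jh,g,f}$.
   Formalization: The basic arrow terms θ_{h,g,f} are restricted to t(g) ≠ t(f), or g or f of the form a·I; otherwise, if α_G(x)=1, θ_{a·I,a·x,a·x} is parallel to, but not equal to, the identity. If no x has α_G(x)=1, nothing changes. *)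

(* Defs.v *)
From mathcomp Require Import all_boot.
From mathcomp Require Import classical_sets.

Set Implicit Arguments.
Unset Strict Implicit.
Unset Printing Implicit Defensive.

Local Open Scope classical_set_scope.

Definition letter := {i : nat | 0 < i}.
Definition word := seq letter.

(* Sets of words; all those arising as [tm_s f] are nominal arities. *)
Definition arity := set word.

Definition dot (a : word) (X : arity) : arity := [set a ++ b | b in X].

(* The set {1, ..., n} of one-letter words. *)
Definition bar (n : nat) : arity := [set [:: i] | i in [set i : letter | val i <= n]].

(* Total version of the graft of [X] on [Y] at [a]; in [tm_s] it is only
   relevant when [a] belongs to [Y] and is a prefix of [X]. *)
Definition graft (Y : arity) (a : word) (X : arity) : arity := (Y `\ a) `|` X.

(* Raw terms: [Gen a x] is a.x, [Unit a] is a.I, and [Ins g f] is the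
   insertion of [f] in [g]. The partiality of insertion is in [is_term]. *)
Inductive term (G : Type) : Type :=
| Gen of word & G
| Unit of word
| Ins of term G & term G.

Arguments Unit {G} _.

Fixpoint tm_t (G : Type) (f : term G) : word :=
  match f with
  | Gen a _ => a
  | Unit a => a
  | Ins g _ => tm_t g
  end.

Fixpoint tm_s (G : Type) (alpha : G -> nat) (f : term G) : arity :=
  match f with
  | Gen a x => if alpha x == 1 then [set a] else dot a (bar (alpha x))
  | Unit a => [set a]
  | Ins g f => graft (tm_s alpha g) (tm_t f) (tm_s alpha f)
  end.

(* [composable alpha g f] also expresses that the object gf is defined. *)
Definition composable (G : Type) (alpha : G -> nat) (g f : term G) : Prop :=
  tm_s alpha g (tm_t f).

Fixpoint is_term (G : Type) (alpha : G -> nat) (f : term G) : Prop :=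
  match f with
  | Gen _ _ => True
  | Unit _ => True
  | Ins g f => [/\ is_term alpha g, is_term alpha f & composable alpha g f]
  end.

Definition is_unit (G : Type) (f : term G) : bool :=
  if f is Unit _ then true else false.

(* Associated to the left and without I. *)
Fixpoint left_normed (G : Type) (f : term G) : bool :=
  match f with
  | Gen _ _ => true
  | Ins g (Gen _ _) => left_normed g
  | _ => false
  end.

Definition object (G : Type) (alpha : G -> nat) (f : term G) : Prop :=
  is_term alpha f /\ (is_unit f || left_normed f).

(* On left-normed terms, read as nonempty words in the letters a.x, this is
   concatenation. *)
Fixpoint concat (G : Type) (g f : term G) : term G :=
  if f is Ins f1 x then Ins (concat g f1) x else Ins g f.

(* The object gf. For objects with [composable alpha g f], if both [g] and [f]
   are of the form a.I then they are equal, so the order of the tests does not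
   matter. *)
Definition juxt (G : Type) (g f : term G) : term G :=
  if is_unit f then g else if is_unit g then f else concat g f.

Declare Scope object_scope.
Delimit Scope object_scope with ob.
Notation "g * f" := (juxt g%ob f%ob) : object_scope.

(* Raw arrow terms; the well-formed ones are those typed by [arrow]. *)
Inductive arr (G : Type) : Type :=
| Id of term G
| Theta of term G & term G & term G
| Comp of arr G & arr G
| Prod of arr G & arr G.

Declare Scope arrow_scope.
Delimit Scope arrow_scope with ar.
Bind Scope arrow_scope with arr.
Notation "v \o u" := (Comp v%ar u%ar) : arrow_scope.
Notation "v * u" := (Prod v%ar u%ar) : arrow_scope.

(* [arrow alpha u f f'] : u is an arrow term of type f -> f'.

   The last premise of [arrow_theta] only matters when [tm_t g = tm_t f]. Since
   the source and the target are defined, [g] and [f] are then, when neither is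
   a.I, nonempty words in letters a.x with the same a and [alpha x = 1]: they
   are not inserted at two places of [h], but composed with each other, and
   theta would exchange them. With such thetas parallel arrow terms need not be
   equal: if [alpha x = 1], letting theta_{h,g,f} contribute (-1)^(|g||f|)
   separates theta_{a.I,a.x,a.x} from the identity of (a.x)(a.x) over G = {x}.
   Without generators x such that [alpha x = 1] the premise always holds. *)
Inductive arrow (G : Type) (alpha : G -> nat) :
    arr G -> term G -> term G -> Prop :=
| arrow_id f : object alpha f -> arrow alpha (Id f) f f
| arrow_theta h g f :
    object alpha h -> object alpha g -> object alpha f ->
    composable alpha h f -> composable alpha h g ->
    composable alpha (h * g)%ob f -> composable alpha (h * f)%ob g ->
    [\/ tm_t g <> tm_t f, is_unit g | is_unit f] ->
    arrow alpha (Theta h g f) (h * g * f)%ob (h * f * g)%ob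
| arrow_comp v u f g h :
    arrow alpha u f g -> arrow alpha v g h -> arrow alpha (v \o u)%ar f h
| arrow_prod v u f f' g g' :
    arrow alpha u f f' -> arrow alpha v g g' ->
    composable alpha g f -> composable alpha g' f' ->
    arrow alpha (v * u)%ar (g * f)%ob (g' * f')%ob.

(* Instances of the equations, on raw arrow terms; [arr_eq] restricts them to
   those whose two sides are arrow terms of the same type. *)
Inductive arr_ax (G : Type) (alpha : G -> nat) : arr G -> arr G -> Prop :=
| ax_comp_idl f u : arr_ax alpha (Id f \o u)%ar u
| ax_comp_idr f u : arr_ax alpha (u \o Id f)%ar u
| ax_comp_assoc w v u : arr_ax alpha (w \o (v \o u))%ar ((w \o v) \o u)%ar
| ax_prod_assoc w v u : arr_ax alpha (w * v * u)%ar (w * (v * u))%ar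
| ax_prod_unitr a u : arr_ax alpha (u * Id (Unit a))%ar u
| ax_prod_unitl a u : arr_ax alpha (Id (Unit a) * u)%ar u
| ax_prod_id g f : arr_ax alpha (Id g * Id f)%ar (Id (g * f)%ob)
| ax_prod_comp v2 v1 u2 u1 :
    arr_ax alpha ((v2 \o v1) * (u2 \o u1))%ar ((v2 * u2) \o (v1 * u1))%ar
| ax_theta_nat u v w f1 f2 g1 g2 h1 h2 :
    arrow alpha u f1 f2 -> arrow alpha v g1 g2 -> arrow alpha w h1 h2 ->
    arr_ax alpha (Theta h2 g2 f2 \o (w * v * u))%ar
                 ((w * u * v) \o Theta h1 g1 f1)%ar
| ax_theta_inv h g f :
    arr_ax alpha (Theta h f g \o Theta h g f)%ar (Id (h * g * f)%ob)
| ax_theta_hexagon j h g f :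
    arr_ax alpha
      (Theta (j * f)%ob h g \o (Theta j h f * Id g) \o Theta (j * h)%ob g f)%ar
      ((Theta j g f * Id h) \o Theta (j * g)%ob h f \o (Theta j h g * Id f))%ar
| ax_theta_idl j h g f :
    arr_ax alpha (Id j * Theta h g f)%ar (Theta (j * h)%ob g f)
| ax_theta_prod j h g f :
    arr_ax alpha (Theta j (h * g)%ob f)
                 ((Theta j h f * Id g) \o Theta (j * h)%ob g f)%ar.

(* Equality of arrow terms in the category. *)
Inductive arr_eq (G : Type) (alpha : G -> nat) : arr G -> arr G -> Prop :=
| arr_eq_ax u v f g :
    arrow alpha u f g -> arrow alpha v f g -> arr_ax alpha u v ->
    arr_eq alpha u v
| arr_eq_refl u f g : arrow alpha u f g -> arr_eq alpha u u
| arr_eq_sym u v : arr_eq alpha u v -> arr_eq alpha v u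
| arr_eq_trans v u w : arr_eq alpha u v -> arr_eq alpha v w -> arr_eq alpha u w
| arr_eq_comp v v' u u' f g :
    arrow alpha (v \o u)%ar f g -> arr_eq alpha v v' -> arr_eq alpha u u' ->
    arr_eq alpha (v \o u)%ar (v' \o u')%ar
| arr_eq_prod v v' u u' f g :
    arrow alpha (v * u)%ar f g -> arr_eq alpha v v' -> arr_eq alpha u u' ->
    arr_eq alpha (v * u)%ar (v' * u')%ar.

(* Main.v *)
Require Import Defs.
From mathcomp Require Import all_boot.
From mathcomp Require Import boolp classical_sets.

Set Implicit Arguments.
Unset Strict Implicit.
Unset Printing Implicit Defensive.

(** An object other than [a.I] is a tree written as a word of nodes [a.x]: each
    node is inserted at a leaf of the tree formed by the nodes before it. A theta
    exchanges two blocks of nodes that sit at different leaves [b] and [c] of the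
    same tree, or it has a block [b.I] and is an identity ([theta_unit]). The leaves form an antichain for the prefix order, so the words of
    the nodes of one block never extend, nor are extended by, those of the other.

    Hence the category behaves like the groupoid of rewritings of a partially
    commutative word, and coherence is a confluence argument, in two steps.

    Every arrow term equals a composite of swaps: thetas that exchange two single
    adjacent nodes, multiplied on the right by the identities of the nodes that
    follow ([arrow_swaps]). The expansion of a theta along a product and its
    involutivity cut an arbitrary theta into such swaps.

    Two different swaps out of one word can be completed to a commuting diagram:
    when they overlap the diagram is the hexagon, and when they do not it is
    naturality of theta ([swaps_join]). Now orient the swaps: two incomparable
    words have a first position at which they differ, and comparing the letters
    there says which one is to the left of the other. Moving the left node forward decreases the number
    of inversions, so by Newman's argument the composites of oriented swaps from
    a word to a sorted word are all equal, and have the same end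
    ([descent_unique]). Every swap is an oriented one or the inverse of one, so it
    commutes with the descents to the sorted word ([swaps_descent]); as these are
    invertible, two parallel arrow terms are equal ([swaps_parallel]). *)

(** * Incomparable words *)

(** The lexicographic order restricted to incomparable words. It is still
    transitive, so that when two oriented swaps overlap, the two outer of the
    three nodes are incomparable as well and can also be swapped. *)
Fixpoint left_of (u v : word) : bool :=
  match u, v with
  | i :: u', j :: v' => (val i < val j) || (i == j) && left_of u' v'
  | _, _ => false
  end.

Definition apart (u v : word) : bool := left_of u v || left_of v u.

Lemma left_of_irr u : left_of u u = false.
Proof. by elim: u => //= i u ->; rewrite ltnn andbF. Qed.

Lemma left_of_trans : transitive left_of.
Proof.
move=> v u w; elim: u v w => [|i u IH] [|j v] [|k w] //=.
case/orP=> [ij|/andP[/eqP-> uv]]; case/orP=> [jk|/andP[/eqP<- vw]].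
- by rewrite (ltn_trans ij jk).
- by rewrite ij.
- by rewrite jk.
- by rewrite eqxx (IH v w uv vw) orbT.
Qed.

Lemma left_of_asym u v : left_of u v -> left_of v u = false.
Proof.
move=> uv; apply/negP => vu; have := left_of_trans uv vu.
by rewrite left_of_irr.
Qed.

Lemma left_of_prefix u v u' v' :
  prefix u u' -> prefix v v' -> left_of u v -> left_of u' v'.
Proof.
move=> /prefixP[x ->] /prefixP[y ->]; elim: u v => [|i u IH] [|j v] //=.
by case/orP=> [-> //|/andP[-> /IH->]]; rewrite orbT.
Qed.

Lemma apartC u v : apart u v = apart v u.
Proof. exact: orbC. Qed.

Lemma apart_irr u : apart u u = false.
Proof. by rewrite /apart left_of_irr. Qed.

Lemma apart_neq u v : apart u v -> u <> v.
Proof. by move=> uv e; rewrite e apart_irr in uv. Qed.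

Lemma apart_prefix u v u' v' :
  prefix u u' -> prefix v v' -> apart u v -> apart u' v'.
Proof.
move=> pu pv /orP[uv|vu]; first by rewrite /apart (left_of_prefix pu pv uv).
by rewrite apartC /apart (left_of_prefix pv pu vu).
Qed.

Lemma apart_last a (i j : letter) : i <> j -> apart (a ++ [:: i]) (a ++ [:: j]).
Proof.
move=> /eqP nij; elim: a => [|k a] /=; last first.
  by rewrite /apart /= !ltnn !eqxx.
by rewrite /apart /= !andbF !orbF -neq_ltn (inj_eq val_inj).
Qed.

(** With [apart] for incomparability, a nominal arity is an antichain. *)
Definition antichain (Y : arity) : Prop :=
  forall b c, Y b -> Y c -> b = c \/ apart b c.

Lemma prefixes_not_apart b c w : prefix b w -> prefix c w -> apart b c = false.
Proof.
move=> bw cw; apply/negP => /(apart_prefix bw cw).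
by rewrite apart_irr.
Qed.

Section Coherence.
Variables (G : Type) (alpha : G -> nat).
Notation node := (word * G)%type.
Notation term := (term G).
Notation arr := (arr G).

Implicit Types (a b c w : word) (p q r : node) (Y : arity) (l m n k : seq node)
  (u v t : arr).

(** * Objects as lists of nodes *)

Definition gen p : term := Gen p.1 p.2.

(** The root [a] tells the objects [a.I] apart, whose list of nodes is empty. On a
    nonempty list it is absorbed; the trees below require it to be the word of the
    first node. *)
Definition mk a l : term := foldl (fun f p => (f * gen p)%ob) (Unit a) l.

Definition outs p : arity := tm_s alpha (gen p).

Definition leaves Y l : arity := foldl (fun Y p => graft Y p.1 (outs p)) Y l.

Fixpoint fits Y l : Prop :=
  if l is p :: l' then Y p.1 /\ fits (graft Y p.1 (outs p)) l' else True.

Notation tree a := (fits [set a]%classic).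
Notation tips a := (leaves [set a]%classic).

Fixpoint nodes (f : term) : seq node :=
  match f with
  | Gen a x => [:: (a, x)]
  | Unit _ => [::]
  | Ins g f => nodes g ++ nodes f
  end.

Lemma mk_rcons a l p : mk a (rcons l p) = (mk a l * gen p)%ob.
Proof. by rewrite /mk foldl_rcons. Qed.

Lemma leaves_rcons Y l p :
  leaves Y (rcons l p) = graft (leaves Y l) p.1 (outs p).
Proof. by rewrite /leaves foldl_rcons. Qed.

Lemma leaves_cat Y l m : leaves Y (l ++ m) = leaves (leaves Y l) m.
Proof. by rewrite /leaves foldl_cat. Qed.

Lemma fits_cat Y l m : fits Y (l ++ m) <-> fits Y l /\ fits (leaves Y l) m.
Proof.
elim: l Y => [|p l IH] Y /=; first by split=> [|[]].
by rewrite IH; split=> [[? []]|[[]]].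
Qed.

Lemma fits_rcons Y l p : fits Y (rcons l p) <-> fits Y l /\ leaves Y l p.1.
Proof. by rewrite -cats1 fits_cat /=; split=> [[? []]|[]]. Qed.

Lemma is_unit_mk a l : is_unit (mk a l) = nilp l.
Proof.
elim/last_ind: l => // l p _; rewrite mk_rcons /nilp size_rcons /juxt /=.
by case: ifP.
Qed.

Lemma juxtA_gen (g f : term) p : ((g * f) * gen p = g * (f * gen p))%ob.
Proof. by case: g f => [b x|b|g h] [c y|c|f k]. Qed.

Lemma juxt_mk a l b m : (mk a l * mk b m)%ob = mk a (l ++ m).
Proof.
elim/last_ind: m => [|m p IH]; first by rewrite cats0.
by rewrite mk_rcons -rcons_cat mk_rcons -juxtA_gen IH.
Qed.

Lemma nodes_mk a l : nodes (mk a l) = l.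
Proof.
elim/last_ind: l => // l p IH; rewrite mk_rcons -cats1 -{2}IH.
by case: (mk a l) p => [b x|b|g f] [].
Qed.

Lemma tm_s_mk a l : tree a l ->
  tm_s alpha (mk a l) = tips a l.
Proof.
elim/last_ind: l => // l p IH /fits_rcons[fl lp].
rewrite mk_rcons leaves_rcons -IH // /juxt /= is_unit_mk.
case: nilP lp => [->|ln] lp //=.
rewrite -[LHS]/(outs p); apply/seteqP; split=> w /= wp; first by right.
by case: wp => // -[/= -> []]; rewrite -lp.
Qed.

Lemma tm_t_mk a l : tree a l -> tm_t (mk a l) = a.
Proof.
elim/last_ind: l => // l p IH /fits_rcons[fl lp].
rewrite mk_rcons /juxt /= is_unit_mk.
by case: nilP lp => [->|ln] lp //=; apply: IH.
Qed.

Lemma composable_mk a l b m :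
  tree a l -> tree b m ->
  composable alpha (mk a l) (mk b m) <-> tips a l b.
Proof. by move=> fl fm; rewrite /composable tm_t_mk // tm_s_mk. Qed.

Lemma object_mk a l : tree a l -> object alpha (mk a l).
Proof.
elim/last_ind: l => // l p IH /fits_rcons[fl lp].
have := IH fl; rewrite mk_rcons /juxt /= is_unit_mk /object => -[tl nl].
case: nilP lp nl => [->|/nilP ln] lp //=.
rewrite is_unit_mk (negPf ln) /= => ->; split=> //; split=> //.
by rewrite /composable tm_s_mk.
Qed.

(** Together with [mk_inj] and [object_mk], this replaces objects by pairs of a
    root and a list of nodes, on which the product is concatenation. *)
Lemma objectP f : object alpha f ->
  exists a l, f = mk a l /\ tree a l.
Proof.
case=> + /orP[]; first by case: f => // a _ _; exists a, [::].
elim: f => [a x|//|g IH f _] /=; first by exists a, [:: (a, x)].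
case: f => // b y [tg _ gy] ng.
have [a [l [gE fl]]] := IH tg ng; subst g.
exists a, (rcons l (b, y)); split.
  rewrite mk_rcons /juxt /= is_unit_mk.
  by case: nilP ng => [->|].
by apply/fits_rcons; split=> //; move: gy; rewrite /composable tm_s_mk.
Qed.

Lemma mk_inj a l b m : tree a l -> tree b m ->
  mk a l = mk b m -> a = b /\ l = m.
Proof.
move=> fl fm e; split; first by rewrite -(tm_t_mk fl) e tm_t_mk.
by rewrite -(nodes_mk a l) e nodes_mk.
Qed.

(** * Leaves *)

Lemma outs_prefix p w : outs p w -> prefix p.1 w.
Proof.
rewrite /outs /=; case: eqP => _; first by move=> /= ->; rewrite prefix_refl.
by case=> x _ <-; rewrite prefix_prefix.
Qed.

Lemma outs_antichain p : antichain (outs p).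
Proof.
rewrite /outs /=; case: eqP => _ b c; first by move=> /= -> ->; left.
move=> [x [i _ <-] <-] [y [j _ <-] <-].
have [->|ij] := eqVneq i j; first by left.
by right; apply/apart_last/eqP.
Qed.

Lemma graft_antichain Y p : antichain Y -> Y p.1 ->
  antichain (graft Y p.1 (outs p)).
Proof.
move=> aY Yp b c; have aux d e : Y d -> d <> p.1 -> outs p e -> apart d e.
  move=> Yd dp /outs_prefix pe; case: (aY d p.1 Yd Yp) => // dp'.
  exact: apart_prefix (prefix_refl d) pe dp'.
case=> [[Yb bp]|ob]; case=> [[Yc cp]|oc].
- exact: aY.
- by right; apply: aux.
- by right; rewrite apartC; apply: aux.
- exact: outs_antichain ob oc.
Qed.

Lemma leaves_antichain Y l : antichain Y -> fits Y l -> antichain (leaves Y l).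
Proof.
elim: l Y => //= p l IH Y aY [Yp fl].
by apply: IH => //; apply: graft_antichain.
Qed.

Lemma set1_antichain a : antichain [set a]%classic.
Proof. by move=> b c /= -> ->; left. Qed.

Lemma fits_antichain a l : tree a l ->
  antichain (tips a l).
Proof. exact/leaves_antichain/set1_antichain. Qed.

Lemma leaves_prefix b m w : tree b m ->
  tips b m w -> prefix b w.
Proof.
elim/last_ind: m w => [|m p IH] w; first by move=> _ /= ->; rewrite prefix_refl.
case/fits_rcons=> fm mp; rewrite leaves_rcons => -[[mw _]|/outs_prefix pw].
  exact: IH.
exact: prefix_trans (IH _ fm mp) pw.
Qed.

(** Inserting [m] at [b] leaves the other leaves untouched: a node of [m] is
    inserted at an extension of [b], and by the antichain condition no leaf of [Y]
    other than [b] is one. *)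
Lemma leaves_graft Y b m : antichain Y -> Y b -> tree b m ->
  fits Y m /\ leaves Y m = graft Y b (tips b m).
Proof.
move=> aY Yb; elim/last_ind: m => [|m p IH].
  move=> _; split=> //; apply/seteqP; split=> w.
    by have [->|wb] := eqVneq w b => Yw; [right|left; split=> //; apply/eqP].
  by case=> [[]|->].
case/fits_rcons=> fm mp; have [fY YE] := IH fm; split.
  by apply/fits_rcons; split=> //; rewrite YE; right.
rewrite !leaves_rcons YE; apply/seteqP; split=> w.
  by case=> [[[[Yw wb]|mw] wp]|ow]; [left|right; left|right; right].
case=> [[Yw wb]|[[mw wp]|ow]]; [|by left; split=> //; right|by right].
left; split; first by left.
move=> wp; have pb := leaves_prefix fm mp; rewrite -wp in pb.
case: (aY w b Yw Yb) => // /(apart_prefix (prefix_refl w) pb).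
by rewrite apart_irr.
Qed.



(** * Arrow terms between lists of nodes *)

Lemma graft_swap Y b c X Z : b <> c -> ~ X c -> ~ Z b ->
  graft (graft Y b X) c Z = graft (graft Y c Z) b X.
Proof.
move=> bc Xc Zb; apply/seteqP; split=> w.
  case=> [[[[Yw wb]|Xw] wc]|Zw]; [|by right|].
  - by left; split=> //; left.
  - by left; split; [right|move=> wb; rewrite wb in Zw].
case=> [[[[Yw wb]|Xw] wc]|Zw]; [| |].
- by left; split=> //; left.
- by right.
- by left; split; [right|move=> wb; rewrite wb in Zw].
Qed.

Lemma leaves_swap a l b m c n :
    tree a l -> tree b m -> tree c n ->
    tips a l b -> tips a l c -> apart b c ->
  [/\ tree a (l ++ m ++ n), tree a (l ++ n ++ m) &
      tips a (l ++ m ++ n) = tips a (l ++ n ++ m)].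
Proof.
move=> fl fm fn lb lc bc; have aY := fits_antichain fl.
have cm : ~ tips b m c.
  move=> /(leaves_prefix fm) pc.
  by have := prefixes_not_apart pc (prefix_refl c); rewrite bc.
have bn : ~ tips c n b.
  move=> /(leaves_prefix fn) pb.
  by have := prefixes_not_apart (prefix_refl b) pb; rewrite bc.
have nbc := apart_neq bc.
have [fYm Ym] := leaves_graft aY lb fm.
have [fYn Yn] := leaves_graft aY lc fn.
have mc : leaves (tips a l) m c by rewrite Ym; left; split=> // /esym.
have nb : leaves (tips a l) n b by rewrite Yn; left; split.
have [fmn Ymn] := leaves_graft (leaves_antichain aY fYm) mc fn.
have [fnm Ynm] := leaves_graft (leaves_antichain aY fYn) nb fm.
split; [by rewrite !fits_cat|by rewrite !fits_cat|].
by rewrite !leaves_cat Ymn Ynm Ym Yn graft_swap.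
Qed.

(** Distinct leaves of one tree are incomparable, so the side condition on theta
    leaves only incomparable blocks and empty ones. *)
Lemma theta_cases a l b m c n : tree a l -> tree b m -> tree c n ->
    tips a l b -> tips a l c ->
    [\/ tm_t (mk b m) <> tm_t (mk c n), is_unit (mk b m) | is_unit (mk c n)] ->
  [\/ apart b c, m = [::] | n = [::]].
Proof.
move=> fl fm fn lb lc; rewrite !is_unit_mk !tm_t_mk //.
case=> [nbc|/nilP->|/nilP->]; [|by constructor 2|by constructor 3].
by case: (fits_antichain fl lb lc) => // bc; constructor 1.
Qed.

(** An arrow term rearranges the nodes of a tree and keeps its root and leaves,
    so that whatever can be inserted in its source can be inserted in its
    target. *)
Lemma arrow_mk u (f g : term) : arrow alpha u f g ->
  exists a l m, [/\ f = mk a l, g = mk a m, tree a l,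
    tree a m &
    tips a l = tips a m].
Proof.
elim=> {u f g}.
- by move=> f /objectP[a [l [-> fl]]]; exists a, l, l.
- move=> h g f /objectP[a [l [-> fl]]] /objectP[b [m [-> fm]]].
  move=> /objectP[c [n [-> fn]]] hf hg hgf hfg hyp.
  move: hf hg => /composable_mk - /(_ fl fn) lc /composable_mk - /(_ fl fm) lb.
  have [fYm Ym] := leaves_graft (fits_antichain fl) lb fm.
  have [fYn Yn] := leaves_graft (fits_antichain fl) lc fn.
  have [bc||] := theta_cases fl fm fn lb lc hyp.
  + have [fmn fnm mn] := leaves_swap fl fm fn lb lc bc.
    by exists a, (l ++ m ++ n), (l ++ n ++ m); rewrite !juxt_mk -!catA.
  + move=> ?; subst m; exists a, (l ++ n), (l ++ n).
    by rewrite !juxt_mk !cats0; split=> //; apply/fits_cat.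
  + move=> ?; subst n; exists a, (l ++ m), (l ++ m).
    by rewrite !juxt_mk !cats0; split=> //; apply/fits_cat.
- move=> v u f g h _ [a [l [m [-> -> fl fm lm]]]] _ [b [m' [n [mE -> fm' fn mn]]]].
  have [? ?] := mk_inj fm fm' mE; subst m' b.
  by exists a, l, n; rewrite lm.
- move=> v u f f' g g' _ [a [l [l' [-> -> fl fl' ll]]]].
  move=> _ [b [m [m' [-> -> fm fm' mm]]]].
  move=> /composable_mk - /(_ fm fl) ma /composable_mk - /(_ fm' fl') ma'.
  exists b, (m ++ l), (m' ++ l'); rewrite !juxt_mk.
  have [fY Y] := leaves_graft (fits_antichain fm) ma fl.
  have [fY' Y'] := leaves_graft (fits_antichain fm') ma' fl'.
  by split; [| | exact/fits_cat | exact/fits_cat | rewrite !leaves_cat Y Y' ll mm].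
Qed.

(** Requiring [l] to be a tree with root [a] makes [a] and [l] determined by the
    source, since [mk] forgets [a] on nonempty lists. *)
Definition hom a l m u : Prop :=
  tree a l /\ arrow alpha u (mk a l) (mk a m).

(** Carrying the typing of both sides along with the equality makes the axioms,
    which hold only between arrow terms of the same type, usable in chains. *)
Definition eqv a l m u v : Prop := [/\ hom a l m u, hom a l m v & arr_eq alpha u v].

Lemma hom_fits a l m u : hom a l m u ->
  [/\ tree a l, tree a m &
      tips a l = tips a m].
Proof.
case=> fl /arrow_mk[b [l' [m' [lE mE fl' fm' lm]]]].
have [? ?] := mk_inj fl fl' lE; subst b l'.
by rewrite -(nodes_mk a m) mE nodes_mk; split.
Qed.

Lemma hom_id a l : tree a l -> hom a l l (Id (mk a l)).
Proof. by move=> fl; split=> //; apply/arrow_id/object_mk. Qed.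

Lemma hom_comp a l m n u v : hom a l m u -> hom a m n v -> hom a l n (v \o u)%ar.
Proof. by case=> fl ul [_ um]; split=> //; apply: arrow_comp ul um. Qed.

Lemma hom_prod a b l l' m m' u v : hom a l l' u -> hom b m m' v ->
  tips b m a -> hom b (m ++ l) (m' ++ l') (v * u)%ar.
Proof.
move=> hu hv ma; have [fl fl' _] := hom_fits hu; have [fm fm' mm] := hom_fits hv.
split.
  by apply/fits_cat; split=> //; case: (leaves_graft (fits_antichain fm) ma fl).
rewrite -(juxt_mk b m a l) -(juxt_mk b m' a l'); case: hu hv => _ hu [_ hv].
by apply: arrow_prod => //; apply/composable_mk => //; rewrite -mm.
Qed.

Lemma fits1 p : tree p.1 [:: p].
Proof. by []. Qed.

Lemma hom_prod_gen a l l' p u : hom a l l' u -> tips a l p.1 ->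
  hom a (rcons l p) (rcons l' p) (u * Id (gen p))%ar.
Proof.
move=> hu lp; rewrite -!cats1; apply: hom_prod hu lp.
exact: (hom_id (fits1 p)).
Qed.

(** This form also covers an empty block, with which a theta may be typed even at
    [b = c]; [hom_theta] is the case of two incomparable leaves. *)
Lemma hom_theta_weak a l b m c n :
    tree a l -> tree b m -> tree c n ->
    tips a l b -> tips a l c ->
    tips a (l ++ m) c -> tips a (l ++ n) b ->
    [\/ b <> c, m = [::] | n = [::]] ->
  hom a (l ++ m ++ n) (l ++ n ++ m) (Theta (mk a l) (mk b m) (mk c n)).
Proof.
move=> fl fm fn lb lc lmc lnb bc.
have [fYm Ym] := leaves_graft (fits_antichain fl) lb fm.
have [fYn Yn] := leaves_graft (fits_antichain fl) lc fn.
have flm : tree a (l ++ m) by apply/fits_cat.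
have fln : tree a (l ++ n) by apply/fits_cat.
have [fmn _] := leaves_graft (fits_antichain flm) lmc fn.
split; first by rewrite catA; apply/fits_cat; split.
rewrite !catA -(juxt_mk _ (l ++ m) c) -(juxt_mk _ (l ++ n) b).
rewrite -(juxt_mk _ l b m) -(juxt_mk _ l c n); apply: arrow_theta; rewrite ?juxt_mk;
  try exact: object_mk; try by apply/composable_mk.
by rewrite !tm_t_mk // !is_unit_mk; case: bc => [|->|->]; constructor.
Qed.

Lemma hom_theta a l b m c n :
    tree a l -> tree b m -> tree c n ->
    tips a l b -> tips a l c -> apart b c ->
  hom a (l ++ m ++ n) (l ++ n ++ m) (Theta (mk a l) (mk b m) (mk c n)).
Proof.
move=> fl fm fn lb lc bc; have nbc := apart_neq bc; have aY := fits_antichain fl.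
have [fYm Ym] := leaves_graft aY lb fm.
have [fYn Yn] := leaves_graft aY lc fn.
apply: hom_theta_weak => //; last by constructor.
  by rewrite leaves_cat Ym; left; split=> // /esym.
by rewrite leaves_cat Yn; left.
Qed.

Lemma eqv_ax a l m u v : hom a l m u -> hom a l m v -> arr_ax alpha u v ->
  eqv a l m u v.
Proof.
move=> hu hv uv; split=> //; case: hu hv => _ hu [_ hv].
exact: arr_eq_ax hu hv uv.
Qed.

Lemma eqv_refl a l m u : hom a l m u -> eqv a l m u u.
Proof. by move=> hu; split=> //; case: hu => _; apply: arr_eq_refl. Qed.

Lemma eqv_sym a l m u v : eqv a l m u v -> eqv a l m v u.
Proof. by case=> hu hv uv; split=> //; apply: arr_eq_sym. Qed.

Lemma eqv_trans a l m v u t : eqv a l m u v -> eqv a l m v t -> eqv a l m u t.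
Proof. by case=> hu _ uv [_ hw vw]; split=> //; apply: arr_eq_trans uv vw. Qed.

Lemma eqv_comp a l m n u u' v v' : eqv a l m u u' -> eqv a m n v v' ->
  eqv a l n (v \o u)%ar (v' \o u')%ar.
Proof.
case=> hu hu' uu [hv hv' vv]; have h := hom_comp hu hv.
split=> //; first exact: hom_comp hu' hv'.
by case: h => _ h; apply: arr_eq_comp h vv uu.
Qed.

Lemma eqv_prod a b l l' m m' u u' v v' :
    eqv a l l' u u' -> eqv b m m' v v' -> tips b m a ->
  eqv b (m ++ l) (m' ++ l') (v * u)%ar (v' * u')%ar.
Proof.
case=> hu hu' uu [hv hv' vv] ma; have h := hom_prod hu hv ma.
split=> //; first exact: hom_prod hu' hv' ma.
by case: h => _ h; apply: arr_eq_prod h vv uu.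
Qed.

Lemma eqv_prod_gen a l l' p u v : eqv a l l' u v -> tips a l p.1 ->
  eqv a (rcons l p) (rcons l' p) (u * Id (gen p))%ar (v * Id (gen p))%ar.
Proof.
move=> uv lp; rewrite -!cats1; apply: eqv_prod uv lp.
exact/eqv_refl/(hom_id (fits1 p)).
Qed.

Lemma eqv_idl a l m u : hom a l m u -> eqv a l m (Id (mk a m) \o u)%ar u.
Proof.
move=> hu; apply: eqv_ax => //; last exact: ax_comp_idl.
by have [_ fm _] := hom_fits hu; apply: hom_comp hu (hom_id fm).
Qed.

Lemma eqv_idr a l m u : hom a l m u -> eqv a l m (u \o Id (mk a l))%ar u.
Proof.
move=> hu; apply: eqv_ax => //; last exact: ax_comp_idr.
by have [fl _ _] := hom_fits hu; apply: hom_comp (hom_id fl) hu.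
Qed.

Lemma eqv_assoc a l m n k u v t : hom a l m u -> hom a m n v -> hom a n k t ->
  eqv a l k (t \o (v \o u))%ar ((t \o v) \o u)%ar.
Proof.
move=> hu hv hw; apply: eqv_ax; last exact: ax_comp_assoc.
  exact: hom_comp (hom_comp hu hv) hw.
exact: hom_comp hu (hom_comp hv hw).
Qed.

Lemma inverse_unique a l m u v v' : hom a l m u ->
    eqv a l l (v \o u)%ar (Id (mk a l)) -> eqv a m m (u \o v')%ar (Id (mk a m)) ->
    hom a m l v -> hom a m l v' ->
  eqv a m l v v'.
Proof.
move=> hu vu uv hv hv'.
apply: eqv_trans (eqv_sym (eqv_idr hv)) _.
apply: eqv_trans (eqv_comp (eqv_sym uv) (eqv_refl hv)) _.
apply: eqv_trans (eqv_assoc hv' hu hv) _.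
apply: eqv_trans (eqv_comp (eqv_refl hv') vu) _.
exact: eqv_idl.
Qed.

Lemma leaves_cat_node a k b l c : tree a k ->
    tree b l -> tips a k b ->
    tips b l c ->
  tips a (k ++ l) c.
Proof.
move=> fk fl kb lc; have [_ E] := leaves_graft (fits_antichain fk) kb fl.
by rewrite leaves_cat E; right.
Qed.

Lemma fits_cat_node a k b l : tree a k ->
    tree b l -> tips a k b ->
  tree a (k ++ l).
Proof.
move=> fk fl kb; apply/fits_cat; split=> //.
by case: (leaves_graft (fits_antichain fk) kb fl).
Qed.

Lemma eqv_interchange a b l1 l2 l3 m1 m2 m3 u1 u2 v1 v2 :
    hom a l1 l2 u1 -> hom a l2 l3 u2 -> hom b m1 m2 v1 -> hom b m2 m3 v2 ->
    tips b m1 a ->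
  eqv b (m1 ++ l1) (m3 ++ l3)
    ((v2 \o v1) * (u2 \o u1))%ar ((v2 * u2) \o (v1 * u1))%ar.
Proof.
move=> h1 h2 k1 k2 ma; apply: eqv_ax; last exact: ax_prod_comp.
  exact: hom_prod (hom_comp h1 h2) (hom_comp k1 k2) ma.
have [_ _ mm] := hom_fits k1.
by apply: hom_comp (hom_prod h1 k1 ma) (hom_prod h2 k2 _); rewrite -mm.
Qed.

Lemma eqv_prod_compl a b k l m n u v :
    tree b k -> hom a l m u -> hom a m n v ->
    tips b k a ->
  eqv b (k ++ l) (k ++ n) (Id (mk b k) * (v \o u))%ar
    ((Id (mk b k) * v) \o (Id (mk b k) * u))%ar.
Proof.
move=> fk hu hv ka; have hk := hom_id fk.
apply: eqv_trans (eqv_interchange hu hv hk hk ka).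
apply: eqv_prod ka; first exact/eqv_refl/(hom_comp hu hv).
exact/eqv_sym/eqv_idl.
Qed.

Lemma eqv_prod_compr a b k l m n u v :
    tree b k -> hom a l m u -> hom a m n v ->
    tips a l b ->
  eqv a (l ++ k) (n ++ k) ((v \o u) * Id (mk b k))%ar
    ((v * Id (mk b k)) \o (u * Id (mk b k)))%ar.
Proof.
move=> fk hu hv lb; have hk := hom_id fk.
apply: eqv_trans (eqv_interchange hk hk hu hv lb).
apply: eqv_prod lb; last exact/eqv_refl/(hom_comp hu hv).
exact/eqv_sym/eqv_idl.
Qed.

Lemma eqv_prod_id a b l m : tree b m -> tree a l ->
    tips b m a ->
  eqv b (m ++ l) (m ++ l) (Id (mk b m) * Id (mk a l))%ar (Id (mk b (m ++ l))).
Proof.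
move=> fm fl ma; apply: eqv_ax.
- exact: hom_prod (hom_id fl) (hom_id fm) ma.
- exact/hom_id/(fits_cat_node fm fl ma).
- by rewrite -(juxt_mk b m a); apply: ax_prod_id.
Qed.

Lemma eqv_prod_assoc a b c l l' m m' k k' u v t :
    hom a l l' u -> hom b m m' v -> hom c k k' t ->
    tips b m a -> tips c k b ->
  eqv c (k ++ m ++ l) (k' ++ m' ++ l') (t * v * u)%ar (t * (v * u))%ar.
Proof.
move=> hu hv ht ma kb; apply: eqv_ax; last exact: ax_prod_assoc.
  rewrite !catA; apply: hom_prod hu (hom_prod hv ht kb) _.
  have [fm _ _] := hom_fits hv; have [fk _ _] := hom_fits ht.
  exact: leaves_cat_node fk fm kb ma.
exact: hom_prod (hom_prod hu hv ma) ht kb.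
Qed.

Lemma eqv_prod_unitr a b l l' u : hom a l l' u -> tips a l b ->
  eqv a l l' (u * Id (Unit b))%ar u.
Proof.
move=> hu lb; apply: eqv_ax => //; last exact: ax_prod_unitr.
rewrite -(cats0 l) -(cats0 l'); apply: hom_prod hu lb.
exact: (@hom_id b [::]).
Qed.

(** * Whiskering *)

(** The nodes of [m] may sit at several leaves of the target of [u], so [m] is
    not an object by itself and is multiplied in one node at a time. *)
Definition whisker u m : arr := foldl (fun u p => (u * Id (gen p))%ar) u m.

Lemma whisker_rcons u m p : whisker u (rcons m p) = (whisker u m * Id (gen p))%ar.
Proof. by rewrite /whisker foldl_rcons. Qed.

Lemma hom_whisker a l l' u m : hom a l l' u ->
  fits (tips a l) m -> hom a (l ++ m) (l' ++ m) (whisker u m).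
Proof.
move=> hu; elim/last_ind: m => [|m p IH]; first by rewrite !cats0.
case/fits_rcons=> fm mp; rewrite whisker_rcons -!rcons_cat.
by apply: hom_prod_gen; [apply: IH|rewrite leaves_cat].
Qed.

Lemma eqv_whisker a l l' u v m : eqv a l l' u v ->
    fits (tips a l) m ->
  eqv a (l ++ m) (l' ++ m) (whisker u m) (whisker v m).
Proof.
move=> uv; elim/last_ind: m => [|m p IH]; first by rewrite !cats0.
case/fits_rcons=> fm mp; rewrite !whisker_rcons -!rcons_cat.
by apply: eqv_prod_gen; [apply: IH|rewrite leaves_cat].
Qed.

Lemma whisker_id a l m : tree a (l ++ m) ->
  eqv a (l ++ m) (l ++ m) (whisker (Id (mk a l)) m) (Id (mk a (l ++ m))).
Proof.
move=> /fits_cat[fl]; elim/last_ind: m => [|m p IH].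
  by rewrite cats0 => _; apply/eqv_refl/hom_id.
case/fits_rcons=> fm mp; rewrite whisker_rcons -!rcons_cat.
have flm : tree a (l ++ m) by apply/fits_cat.
rewrite -leaves_cat in mp; apply: eqv_trans (eqv_prod_gen (IH fm) mp) _.
by rewrite -cats1; apply: (eqv_prod_id flm (fits1 p)).
Qed.

Lemma whisker_comp a l m n k u v : hom a l m u -> hom a m n v ->
    fits (tips a l) k ->
  eqv a (l ++ k) (n ++ k) (whisker (v \o u)%ar k)
    (whisker v k \o whisker u k)%ar.
Proof.
move=> hu hv; have [_ _ lm] := hom_fits hu.
elim/last_ind: k => [|k p IH].
  by rewrite !cats0 => _; apply/eqv_refl/(hom_comp hu hv).
case/fits_rcons=> fk kp; rewrite !whisker_rcons -!rcons_cat.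
rewrite -leaves_cat in kp; apply: eqv_trans (eqv_prod_gen (IH fk) kp) _.
rewrite -!cats1; apply: (eqv_prod_compr (fits1 p) (hom_whisker hu fk) _ kp).
by apply: hom_whisker hv _; rewrite -lm.
Qed.

Lemma eqv_prodr_whisker a b l l' m u : hom a l l' u ->
    tree b m -> tips a l b ->
  eqv a (l ++ m) (l' ++ m) (u * Id (mk b m))%ar (whisker u m).
Proof.
move=> hu + lb; have [fl _ _] := hom_fits hu.
elim/last_ind: m => [|m p IH].
  by rewrite !cats0 => _; apply: eqv_prod_unitr.
case/fits_rcons=> fm mp; rewrite !whisker_rcons -!rcons_cat.
apply: eqv_trans (eqv_prod_gen (IH fm) (leaves_cat_node fl fm lb mp)).
have hm := hom_id fm.
have hp : hom p.1 [:: p] [:: p] (Id (gen p)) := hom_id (fits1 p).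
rewrite -!cats1 -!catA.
apply: eqv_trans (eqv_sym (eqv_prod_assoc hp hm hu mp lb)).
apply: eqv_prod lb; last exact: eqv_refl.
exact/eqv_sym/(eqv_prod_id fm (fits1 p)).
Qed.

Lemma eqv_prodl_whisker a b k l l' m u : hom a l l' u ->
    tree b k -> tips b k a ->
    fits (tips a l) m ->
  eqv b (k ++ l ++ m) (k ++ l' ++ m) (Id (mk b k) * whisker u m)%ar
    (whisker (Id (mk b k) * u)%ar m).
Proof.
move=> hu fk ka; have hk := hom_id fk; have [fl _ _] := hom_fits hu.
elim/last_ind: m => [|m p IH].
  by rewrite !cats0 => _; apply/eqv_refl/(hom_prod hu hk ka).
case/fits_rcons=> fm mp; rewrite !whisker_rcons -!rcons_cat.
have flm : tree a (l ++ m) by apply/fits_cat.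
have hp : hom p.1 [:: p] [:: p] (Id (gen p)) := hom_id (fits1 p).
rewrite -leaves_cat in mp.
have hw := hom_whisker hu fm.
apply: eqv_trans (eqv_prod_gen (IH fm) (leaves_cat_node fk flm ka mp)).
rewrite -!cats1 -!catA; apply: eqv_sym.
by have := eqv_prod_assoc hp hw hk mp ka; rewrite -!catA.
Qed.

(** * Swaps of adjacent nodes *)

Definition swap a l p q m : arr := whisker (Theta (mk a l) (gen p) (gen q)) m.

(** A node incomparable with the one before it cannot be inserted at one of the
    new leaves of the latter, so both sit at leaves of [l]. *)
Lemma fits_swap a l p q m : tree a (l ++ p :: q :: m) ->
    apart p.1 q.1 ->
  [/\ tree a l, tips a l p.1,
      tips a l q.1 &
      fits (tips a (l ++ [:: p; q])) m].
Proof.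
move=> /fits_cat[fl [lp [lq fm]]] pq; split=> //; last by rewrite leaves_cat.
case: lq => [[]//|/outs_prefix pre].
by move: (prefixes_not_apart pre (prefix_refl _)); rewrite pq.
Qed.

Lemma hom_swap a l p q m : tree a (l ++ p :: q :: m) ->
    apart p.1 q.1 ->
  hom a (l ++ p :: q :: m) (l ++ q :: p :: m) (swap a l p q m).
Proof.
move=> fl pq; have [fl' lp lq fm] := fits_swap fl pq.
have := hom_whisker (hom_theta fl' (fits1 p) (fits1 q) lp lq pq) fm.
by rewrite -!catA.
Qed.

Lemma theta_inv a l b m c n :
    tree a l -> tree b m -> tree c n ->
    tips a l b -> tips a l c -> apart b c ->
  eqv a (l ++ m ++ n) (l ++ m ++ n)
    (Theta (mk a l) (mk c n) (mk b m) \o Theta (mk a l) (mk b m) (mk c n))%ar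
    (Id (mk a (l ++ m ++ n))).
Proof.
move=> fl fm fn lb lc bc; have h := hom_theta fl fm fn lb lc bc.
rewrite apartC in bc; have h' := hom_theta fl fn fm lc lb bc.
apply: eqv_ax (hom_comp h h') _ _; first by apply: hom_id; case: h.
by rewrite catA -(juxt_mk _ (l ++ m) c) -(juxt_mk _ l b); apply: ax_theta_inv.
Qed.

Lemma swap_inv a l p q m : tree a (l ++ p :: q :: m) ->
    apart p.1 q.1 ->
  eqv a (l ++ p :: q :: m) (l ++ p :: q :: m)
    (swap a l q p m \o swap a l p q m)%ar (Id (mk a (l ++ p :: q :: m))).
Proof.
move=> fl pq; have [fl' lp lq fm] := fits_swap fl pq.
have h := hom_theta fl' (fits1 p) (fits1 q) lp lq pq.
have e := theta_inv fl' (fits1 p) (fits1 q) lp lq pq.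
rewrite apartC in pq; have h' := hom_theta fl' (fits1 q) (fits1 p) lq lp pq.
have := eqv_trans (eqv_sym (whisker_comp h h' fm)) (eqv_whisker e fm).
rewrite -!catA => e'; apply: eqv_trans e' _.
by have := @whisker_id a (l ++ [:: p; q]) m; rewrite -!catA; apply.
Qed.

Lemma eqv_prodl_swap a b k l p q m : tree b k ->
    tips b k a -> tree a (l ++ p :: q :: m) ->
    apart p.1 q.1 ->
  eqv b (k ++ l ++ p :: q :: m) (k ++ l ++ q :: p :: m)
    (Id (mk b k) * swap a l p q m)%ar (swap b (k ++ l) p q m).
Proof.
move=> fk ka fl pq; have [fl' lp lq fm] := fits_swap fl pq.
have hT := hom_theta fl' (fits1 p) (fits1 q) lp lq pq.
have := eqv_prodl_whisker hT fk ka fm; rewrite -!catA => e.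
apply: eqv_trans e _.
have := fits_cat_node fk fl ka; rewrite catA => fkl.
have [fkl' kp kq fm'] := fits_swap fkl pq.
have hT' := hom_theta fkl' (fits1 p) (fits1 q) kp kq pq.
have e : eqv b ((k ++ l) ++ [:: p; q]) ((k ++ l) ++ [:: q; p])
    (Id (mk b k) * Theta (mk a l) (gen p) (gen q))%ar
    (Theta (mk b (k ++ l)) (gen p) (gen q)).
  apply: eqv_ax; [|exact: hT'|].
    by rewrite -!catA; apply: hom_prod hT (hom_id fk) ka.
  by rewrite -(juxt_mk b k a); apply: ax_theta_idl.
by have := eqv_whisker e fm'; rewrite -!catA.
Qed.

(** The relation [R] selects the pairs of words that may be exchanged, so that
    arbitrary composites of swaps and the oriented ones share their theory.
    Building [eqv] into the constructors makes the family of arrow terms closed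
    under equality. *)
Inductive swaps (R : rel word) a : seq node -> seq node -> arr -> Prop :=
| swaps_id l u : eqv a l l u (Id (mk a l)) -> swaps R a l l u
| swaps_step l p q m n u v :
    tree a (l ++ p :: q :: m) -> apart p.1 q.1 -> R p.1 q.1 ->
    swaps R a (l ++ q :: p :: m) n u ->
    eqv a (l ++ p :: q :: m) n v (u \o swap a l p q m)%ar ->
    swaps R a (l ++ p :: q :: m) n v.

Section Swaps.
Variable R : rel word.

Lemma swaps_eqv a l m u v : eqv a l m u v -> swaps R a l m u -> swaps R a l m v.
Proof.
move=> /eqv_sym uv s; case: s uv => {l m u}.
  by move=> l u uE vu; apply/swaps_id/(eqv_trans vu).
move=> l p q m n u t fl pq Rpq s tE vt.
exact: swaps_step fl pq Rpq s (eqv_trans vt tE).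
Qed.

Lemma hom_swaps a l m u : swaps R a l m u -> hom a l m u.
Proof. by case=> [l0 v|l0 p q m0 n t v _ _ _ _] []. Qed.

Lemma swaps_comp a l m n u v : swaps R a l m u -> swaps R a m n v ->
  swaps R a l n (v \o u)%ar.
Proof.
move=> s sv; elim: s sv => {l m u} [l u uE sv|l p q m m' u t fl pq Rpq s IH tE sv].
  have hv := hom_swaps sv; apply: swaps_eqv sv; apply: eqv_sym.
  exact: eqv_trans (eqv_comp uE (eqv_refl hv)) (eqv_idr hv).
have hv := hom_swaps sv; apply: (swaps_step fl pq Rpq (IH sv)).
have hu := hom_swaps s.
apply: eqv_trans (eqv_comp tE (eqv_refl hv)) _.
exact: eqv_assoc (hom_swap fl pq) hu hv.
Qed.

Lemma swaps_swap a l p q m : tree a (l ++ p :: q :: m) ->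
    apart p.1 q.1 -> R p.1 q.1 ->
  swaps R a (l ++ p :: q :: m) (l ++ q :: p :: m) (swap a l p q m).
Proof.
move=> fl pq Rpq; have h := hom_swap fl pq; have [_ fl' _] := hom_fits h.
apply: (swaps_step fl pq Rpq _ (eqv_sym (eqv_idl h))).
exact/swaps_id/eqv_refl/hom_id.
Qed.

Lemma swaps_whisker a l m u k : swaps R a l m u ->
  fits (tips a l) k -> swaps R a (l ++ k) (m ++ k) (whisker u k).
Proof.
elim=> {l m u} [l u uE fk|l p q m m' u t fl pq Rpq s IH tE fk].
  have [[fl _] _ _] := uE.
  apply/swaps_id/(eqv_trans (eqv_whisker uE fk))/whisker_id.
  exact/fits_cat.
have h := hom_swap fl pq; have [_ _ lE] := hom_fits h.
apply: swaps_eqv (eqv_sym (eqv_whisker tE fk)) _.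
apply: swaps_eqv (eqv_sym (whisker_comp h (hom_swaps s) fk)) _.
apply: swaps_comp (IH _); last by rewrite -lE.
rewrite -!catA /= /swap /whisker -foldl_cat; apply: swaps_swap => //.
by have/fits_cat := conj fl fk; rewrite -catA.
Qed.

Lemma swaps_prodl a b k l m u : swaps R a l m u -> tree b k ->
    tips b k a ->
  swaps R b (k ++ l) (k ++ m) (Id (mk b k) * u)%ar.
Proof.
move=> + fk ka; elim=> {l m u} [l u uE|l p q m m' u t fl pq Rpq s IH tE].
  have [[fl _] _ _] := uE; have hk := hom_id fk.
  apply/swaps_id/(eqv_trans (eqv_prod uE (eqv_refl hk) ka)).
  exact: eqv_prod_id.
have h := hom_swap fl pq; have hk := hom_id fk.
apply: swaps_eqv (eqv_sym (eqv_prod tE (eqv_refl hk) ka)) _.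
apply: swaps_eqv (eqv_sym (eqv_prod_compl fk h (hom_swaps s) ka)) _.
apply: swaps_comp IH.
have flm := fits_cat_node fk fl ka.
apply: swaps_eqv (eqv_sym (eqv_prodl_swap fk ka fl pq)) _.
by rewrite !(catA k l) in flm *; apply: swaps_swap.
Qed.

End Swaps.

Definition any_pair : rel word := fun _ _ => true.

Lemma swaps_sub (R R' : rel word) a l m u : subrel R R' ->
  swaps R a l m u -> swaps R' a l m u.
Proof.
move=> RR; elim=> {l m u} [l u uE|l p q m n u v fl pq Rpq s IH vE].
  exact: swaps_id.
exact: swaps_step fl pq (RR _ _ Rpq) IH vE.
Qed.

Definition inverse a l m u v : Prop :=
  eqv a l l (v \o u)%ar (Id (mk a l)) /\ eqv a m m (u \o v)%ar (Id (mk a m)).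

Lemma eqv_cancel a l m n u u' v v' :
    hom a l m u -> hom a m n v -> hom a n m v' -> hom a m l u' ->
    eqv a l l (u' \o u)%ar (Id (mk a l)) -> eqv a m m (v' \o v)%ar (Id (mk a m)) ->
  eqv a l l ((u' \o v') \o (v \o u))%ar (Id (mk a l)).
Proof.
move=> hu hv hv' hu' uu vv.
apply: eqv_trans (eqv_sym (eqv_assoc (hom_comp hu hv) hv' hu')) _.
apply: eqv_trans (eqv_comp (eqv_assoc hu hv hv') (eqv_refl hu')) _.
apply: eqv_trans (eqv_comp (eqv_comp (eqv_refl hu) vv) (eqv_refl hu')) _.
exact: eqv_trans (eqv_comp (eqv_idl hu) (eqv_refl hu')) uu.
Qed.

Lemma swaps_inv a l m u : swaps any_pair a l m u ->
  exists2 v, swaps any_pair a m l v & inverse a l m u v.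
Proof.
elim=> {l m u} [l u uE|l p q m n u v fl pq _ s [u' s' [uu uu']] vE].
  have [hu hid _] := uE; exists (Id (mk a l)); first exact/swaps_id/eqv_refl.
  by split; [apply: eqv_trans (eqv_idl hu) uE|apply: eqv_trans (eqv_idr hu) uE].
have h := hom_swap fl pq; have [_ fl' _] := hom_fits h.
have qp : apart q.1 p.1 by rewrite apartC.
have h' := hom_swap fl' qp.
exists (swap a l q p m \o u')%ar.
  by apply: swaps_comp s' _; apply: swaps_swap.
have hu := hom_swaps s; have hu' := hom_swaps s'.
have hh := eqv_refl (hom_comp hu' h').
split.
  apply: eqv_trans (eqv_comp vE hh) _.
  exact: (eqv_cancel h hu hu' h' (swap_inv fl pq) uu).
apply: eqv_trans (eqv_comp hh vE) _.
exact: (eqv_cancel hu' h' h hu uu' (swap_inv fl' qp)).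
Qed.

(** * Every arrow term is a composite of swaps *)

(** As [I] composed with [I] is [I], the expansion of theta along a product makes
    theta with [I] idempotent; it is also invertible, hence an identity. *)
Lemma theta_unit a l b c n :
    tree a l -> tree c n ->
    tips a l b -> tips a l c ->
    tips a (l ++ n) b ->
  eqv a (l ++ n) (l ++ n) (Theta (mk a l) (Unit b) (mk c n)) (Id (mk a (l ++ n))) /\
  eqv a (l ++ n) (l ++ n) (Theta (mk a l) (mk c n) (Unit b)) (Id (mk a (l ++ n))).
Proof.
move=> fl fn lb lc lnb.
have fI : tree b [::] by [].
have lIc : tips a (l ++ [::]) c by rewrite cats0.
have hT : hom a (l ++ n) (l ++ n) (Theta (mk a l) (Unit b) (mk c n)).
  rewrite -{2}(cats0 (l ++ n)) -catA.
  by apply: (hom_theta_weak fl fI fn lb lc) => //; constructor.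
have hT' : hom a (l ++ n) (l ++ n) (Theta (mk a l) (mk c n) (Unit b)).
  rewrite -{1}(cats0 (l ++ n)) -catA.
  by apply: (hom_theta_weak fl fn fI lc lb) => //; constructor.
have [fln _ _] := hom_fits hT.
set T := Theta _ _ _ in hT *; set T' := Theta _ _ _ in hT' *.
have inv : eqv a (l ++ n) (l ++ n) (T' \o T)%ar (Id (mk a (l ++ n))).
  apply: eqv_ax (hom_comp hT hT') (hom_id fln) _.
  by rewrite -(juxt_mk a l c); apply: (ax_theta_inv alpha (mk a l) (Unit b)).
have idem : eqv a (l ++ n) (l ++ n) T (T \o T)%ar.
  have hTI : hom a (l ++ n) (l ++ n) (T * Id (Unit b))%ar.
    rewrite -(cats0 (l ++ n)).
    exact: (hom_prod (hom_id fI : hom b [::] [::] (Id (Unit b))) hT).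
  have e : eqv a (l ++ n) (l ++ n) T ((T * Id (Unit b)) \o T)%ar.
    apply: eqv_ax hT (hom_comp hT hTI) _.
    exact: (ax_theta_prod alpha (mk a l) (Unit b) (Unit b) (mk c n)).
  apply: eqv_trans e (eqv_comp (eqv_refl hT) _).
  exact: eqv_prod_unitr.
have T1 : eqv a (l ++ n) (l ++ n) T (Id (mk a (l ++ n))).
  apply: eqv_trans (eqv_sym (eqv_idl hT)) _.
  apply: eqv_trans (eqv_comp (eqv_refl hT) (eqv_sym inv)) _.
  apply: eqv_trans (eqv_sym (eqv_assoc hT hT hT')) _.
  exact: eqv_trans (eqv_comp (eqv_sym idem) (eqv_refl hT')) inv.
split=> //; apply: eqv_trans (eqv_sym (eqv_idr hT')) _.
exact: eqv_trans (eqv_comp (eqv_sym T1) (eqv_refl hT')) inv.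
Qed.

(** The expansion of theta along a product, with [q] as the last factor: moving
    [n] before [m q] is moving it before [q], then before [m]. *)
Lemma theta_rcons a l b m q c n :
    tree a l -> tree b (rcons m q) ->
    tree c n ->
    tips a l b -> tips a l c -> apart b c ->
  eqv a (l ++ rcons m q ++ n) (l ++ n ++ rcons m q)
    (Theta (mk a l) (mk b (rcons m q)) (mk c n))
    ((Theta (mk a l) (mk b m) (mk c n) * Id (gen q)) \o
       Theta (mk a (l ++ m)) (gen q) (mk c n))%ar.
Proof.
move=> fl fmq fn lb lc bc; have [fm mq] := (fits_rcons _ _ _).1 fmq.
have [flm Elm] := leaves_graft (fits_antichain fl) lb fm.
have h := hom_theta fl fmq fn lb lc bc.
have h1 := hom_theta fl fm fn lb lc bc.
have lmc : tips a (l ++ m) c.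
  by rewrite leaves_cat Elm; left; split=> // /esym; apply: apart_neq.
have lmq := leaves_cat_node fl fm lb mq.
have qc : apart q.1 c.
  exact: apart_prefix (leaves_prefix fm mq) (prefix_refl c) bc.
have h2 := hom_theta (fits_cat_node fl fm lb) (fits1 q) fn lmq lmc qc.
have h3 : hom a (rcons (l ++ m ++ n) q) (rcons (l ++ n ++ m) q)
    (Theta (mk a l) (mk b m) (mk c n) * Id (gen q))%ar.
  apply: (hom_prod_gen h1).
  have [_ _ ->] := hom_fits h1.
  have [fln Eln] := leaves_graft (fits_antichain fl) lc fn.
  have lnb : tips a (l ++ n) b.
    by rewrite leaves_cat Eln; left; split=> //; apply: apart_neq.
  by rewrite catA; apply: leaves_cat_node mq => //; apply: fits_cat_node lc.
apply: eqv_ax => //.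
  rewrite -!cats1 -!catA in h2 h3 *.
  exact: hom_comp h2 h3.
by rewrite mk_rcons -(juxt_mk a l b); apply: ax_theta_prod.
Qed.

Notation all_swaps := (swaps any_pair).

(** Reduces the block [m] in a theta to single nodes, for a fixed block [n]. The
    axioms split only the first of the two exchanged blocks; the other one is
    reached by applying this lemma to the inverse thetas ([swaps_theta_sym]). *)
Lemma swaps_theta_ind c n : tree c n ->
    (forall a l q, tree a l -> tips a l q.1 ->
       tips a l c -> apart q.1 c ->
       all_swaps a (l ++ q :: n) (l ++ rcons n q)
         (Theta (mk a l) (gen q) (mk c n))) ->
  forall a l b m, tree a l -> tree b m ->
    tips a l b -> tips a l c -> apart b c ->
  all_swaps a (l ++ m ++ n) (l ++ n ++ m) (Theta (mk a l) (mk b m) (mk c n)).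
Proof.
move=> fn swaps1 a l b m fl + lb lc bc.
have aY := fits_antichain fl; have nbc := apart_neq bc.
elim/last_ind: m => [_|m q IH fmq].
  have [fln Eln] := leaves_graft aY lc fn.
  have lnb : tips a (l ++ n) b by rewrite leaves_cat Eln; left.
  rewrite cats0; apply: swaps_id.
  by have [] := theta_unit fl fn lb lc lnb.
apply: swaps_eqv (eqv_sym (theta_rcons fl fmq fn lb lc bc)) _.
have [fm mq] := (fits_rcons _ _ _).1 fmq.
have flm := fits_cat_node fl fm lb.
have lmq := leaves_cat_node fl fm lb mq.
have [fYm Elm] := leaves_graft aY lb fm.
have lmc : tips a (l ++ m) c.
  by rewrite leaves_cat Elm; left; split=> // /esym.
have qc : apart q.1 c.
  exact: apart_prefix (leaves_prefix fm mq) (prefix_refl c) bc.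
have s1 := swaps1 a (l ++ m) q flm lmq lmc qc.
have [fs1 fs1' _] := hom_fits (hom_swaps s1).
have fq : fits (tips a (l ++ m ++ n)) [:: q].
  by move: fs1'; rewrite -cats1 !catA fits_cat => -[].
have := swaps_whisker (IH fm) fq.
rewrite -!cats1 -!catA /= in s1 *; exact: swaps_comp.
Qed.

Lemma swaps_theta_sym a l b m c n :
    tree a l -> tree b m -> tree c n ->
    tips a l b -> tips a l c -> apart b c ->
    all_swaps a (l ++ m ++ n) (l ++ n ++ m) (Theta (mk a l) (mk b m) (mk c n)) ->
  all_swaps a (l ++ n ++ m) (l ++ m ++ n) (Theta (mk a l) (mk c n) (mk b m)).
Proof.
move=> fl fm fn lb lc bc /swaps_inv[v sv [vu uv]].
have hv := hom_swaps sv; apply: swaps_eqv sv.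
have h := hom_theta fl fm fn lb lc bc.
rewrite apartC in bc; have h' := hom_theta fl fn fm lc lb bc.
exact: (inverse_unique h vu (theta_inv fl fn fm lc lb bc) hv h').
Qed.

Lemma swaps_theta a l b m c n :
    tree a l -> tree b m -> tree c n ->
    tips a l b -> tips a l c -> apart b c ->
  all_swaps a (l ++ m ++ n) (l ++ n ++ m) (Theta (mk a l) (mk b m) (mk c n)).
Proof.
move=> fl fm fn lb lc bc.
apply: (swaps_theta_ind fn) => // a' l' q fl' lq' lc' qc'.
have cq : apart c q.1 by rewrite apartC.
rewrite -cats1; apply: (swaps_theta_sym fl' fn (fits1 q)) => //.
apply: (swaps_theta_ind (fits1 q)) => // a2 l2 p fl2 lp2 lq2 pq2.
have fl2' : tree a2 (l2 ++ [:: p; q]).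
  by have [] := hom_theta fl2 (fits1 p) (fits1 q) lp2 lq2 pq2.
exact: (@swaps_swap any_pair a2 l2 p q [::]).
Qed.

(** A product of arrow terms is split by interchange into a part that acts on its
    left factor and one that acts on its right factor; both kinds of
    multiplication by an identity send swaps to swaps. *)
Lemma arrow_swaps u (f g : term) : arrow alpha u f g ->
  exists a l m, [/\ f = mk a l, g = mk a m & all_swaps a l m u].
Proof.
have id_swaps a l : tree a l -> all_swaps a l l (Id (mk a l)).
  by move=> fl; apply/swaps_id/eqv_refl/hom_id.
elim=> {u f g}.
- by move=> f /objectP[a [l [-> fl]]]; exists a, l, l; split=> //; apply: id_swaps.
- move=> h g f /objectP[a [l [-> fl]]] /objectP[b [m [-> fm]]].
  move=> /objectP[c [n [-> fn]]] hf hg hgf hfg hyp.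
  move: hf hg => /composable_mk - /(_ fl fn) lc /composable_mk - /(_ fl fm) lb.
  move: hgf hfg; rewrite !juxt_mk.
  move=> /composable_mk - /(_ (fits_cat_node fl fm lb) fn) lmc.
  move=> /composable_mk - /(_ (fits_cat_node fl fn lc) fm) lnb.
  have [bc||] := theta_cases fl fm fn lb lc hyp.
  + exists a, (l ++ m ++ n), (l ++ n ++ m); rewrite -!catA; split=> //.
    exact: swaps_theta.
  + move=> ?; subst m; exists a, (l ++ n), (l ++ n); rewrite !cats0; split=> //.
    by apply: swaps_id; have [] := theta_unit fl fn lb lc lnb.
  + move=> ?; subst n; exists a, (l ++ m), (l ++ m); rewrite !cats0; split=> //.
    by apply: swaps_id; have [] := theta_unit fl fm lc lb lmc.
- move=> v u f g h _ [a [l [m [-> -> su]]]] _ [b [m' [n [mE -> sv]]]].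
  have [_ fm _] := hom_fits (hom_swaps su).
  have [fm' _ _] := hom_fits (hom_swaps sv).
  have [? ?] := mk_inj fm fm' mE; subst m' b.
  by exists a, l, n; split=> //; apply: swaps_comp su sv.
- move=> v u f f' g g' _ [a [l [l' [-> -> su]]]] _ [b [m [m' [-> -> sv]]]].
  have hu := hom_swaps su; have hv := hom_swaps sv.
  have [fl fl' ll] := hom_fits hu; have [fm fm' mm] := hom_fits hv.
  move=> /composable_mk - /(_ fm fl) ma /composable_mk - /(_ fm' fl') ma'.
  exists b, (m ++ l), (m' ++ l'); rewrite !juxt_mk; split=> //.
  have hl := hom_id fl'; have hm := hom_id fm.
  have e : eqv b (m ++ l) (m' ++ l') (v * u)%ar
      ((v * Id (mk a l')) \o (Id (mk b m) * u))%ar.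
    apply: eqv_trans (eqv_interchange hu hl hm hv ma).
    by apply: eqv_prod ma; [apply/eqv_sym/eqv_idl|apply/eqv_sym/eqv_idr].
  apply: swaps_eqv (eqv_sym e) _.
  apply: swaps_comp (swaps_prodl su fm ma) _.
  apply: swaps_eqv (eqv_sym (eqv_prodr_whisker hv fl' ma)) _.
  by apply: swaps_whisker sv _; case: (leaves_graft (fits_antichain fm) ma fl').
Qed.

(** * Confluence of oriented swaps *)

Definition right_of : rel word := fun b c => left_of c b.

Lemma right_apart b c : right_of b c -> apart b c.
Proof. by move=> bc; apply/orP; right. Qed.

Fixpoint inversions l : nat :=
  if l is p :: l' then count (fun q => right_of p.1 q.1) l' + inversions l' else 0.

Lemma inversions_swap l p q m : right_of p.1 q.1 ->
  inversions (l ++ q :: p :: m) < inversions (l ++ p :: q :: m).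
Proof.
move=> pq; elim: l => [|r l IH] /=; last first.
  by rewrite !count_cat /= (addnCA (right_of r.1 q.1)) ltn_add2l.
rewrite pq {1}/right_of (left_of_asym pq) add0n add1n addSn ltnS.
by rewrite addnCA.
Qed.

Definition sorted_nodes l : Prop :=
  forall k p q m, l = k ++ p :: q :: m -> ~~ right_of p.1 q.1.

Notation descent := (swaps right_of).

Lemma descent_swap a l p q m : tree a (l ++ p :: q :: m) ->
    right_of p.1 q.1 ->
  descent a (l ++ p :: q :: m) (l ++ q :: p :: m) (swap a l p q m).
Proof. by move=> fl pq; apply: swaps_swap => //; apply: right_apart. Qed.

(** Naturality of the theta that exchanges [r] and [s], in the tree in which these
    are inserted: the swap of [p] and [q] is an arrow between two such trees. *)
Lemma swap_comm a l p q k r s m :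
    tree a (l ++ p :: q :: k ++ r :: s :: m) ->
    apart p.1 q.1 -> apart r.1 s.1 ->
  eqv a (l ++ p :: q :: k ++ r :: s :: m) (l ++ q :: p :: k ++ s :: r :: m)
    (swap a (l ++ q :: p :: k) r s m \o swap a l p q (k ++ r :: s :: m))%ar
    (swap a l p q (k ++ s :: r :: m) \o swap a (l ++ p :: q :: k) r s m)%ar.
Proof.
move=> fl pq rs; have [fl' lp lq fm] := fits_swap fl pq.
have fkm := fl.
rewrite -[_ :: _ :: _ ++ _]/((p :: q :: k) ++ r :: s :: m) catA in fkm.
have [fk kr ks fm'] := fits_swap fkm rs.
have hw := hom_swap fk pq; have [_ fk' kk] := hom_fits hw.
have kr' := kr; have ks' := ks; rewrite kk in kr' ks'.
have hT1 := hom_theta fk (fits1 r) (fits1 s) kr ks rs.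
have hT2 := hom_theta fk' (fits1 r) (fits1 s) kr' ks' rs.
have hr := hom_id (fits1 r); have hs := hom_id (fits1 s).
have hrs : hom a ((l ++ p :: q :: k) ++ [:: r; s]) ((l ++ q :: p :: k) ++ [:: r; s])
    (swap a l p q (k ++ [:: r; s])).
  rewrite -!catA; apply: hom_swap pq.
  by have [+ _] := hT1; rewrite -!catA.
have hsr : hom a ((l ++ p :: q :: k) ++ [:: s; r]) ((l ++ q :: p :: k) ++ [:: s; r])
    (swap a l p q (k ++ [:: s; r])).
  rewrite -!catA; apply: hom_swap pq.
  by have [_ + _] := hom_fits hT1; rewrite -!catA.
have sE x y : swap a l p q (k ++ [:: x; y]) =
    (swap a l p q k * Id (gen x) * Id (gen y))%ar.
  by rewrite /swap /whisker foldl_cat.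
have e : eqv a ((l ++ p :: q :: k) ++ [:: r; s]) ((l ++ q :: p :: k) ++ [:: s; r])
    (Theta (mk a (l ++ q :: p :: k)) (gen r) (gen s) \o
       swap a l p q (k ++ [:: r; s]))%ar
    (swap a l p q (k ++ [:: s; r]) \o
       Theta (mk a (l ++ p :: q :: k)) (gen r) (gen s))%ar.
  apply: eqv_ax; [exact: hom_comp hrs hT2|exact: hom_comp hT1 hsr|].
  rewrite !sE; case: hr hs hw => _ hr [_ hs] [_ hw].
  exact: ax_theta_nat hs hr hw.
have [_ _ krs] := hom_fits hT1; have [_ _ krs'] := hom_fits hrs.
have := eqv_trans (eqv_sym (whisker_comp hrs hT2 fm')) (eqv_whisker e fm').
move/eqv_trans => /(_ _ (whisker_comp hT1 hsr fm')).
by rewrite /swap /whisker -!foldl_cat -!catA.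
Qed.

Lemma whisker_comp3 a l m n k j u v t : hom a l m u -> hom a m n v ->
    hom a n k t -> fits (tips a l) j ->
  eqv a (l ++ j) (k ++ j) (whisker t j \o whisker v j \o whisker u j)%ar
    (whisker (t \o v \o u)%ar j).
Proof.
move=> hu hv ht fj; have [_ _ lm] := hom_fits hu.
apply: eqv_sym; apply: eqv_trans (whisker_comp hu (hom_comp hv ht) fj) _.
apply: eqv_comp (eqv_refl (hom_whisker hu fj)) _.
by apply: whisker_comp hv ht _; rewrite -lm.
Qed.

(** The hexagon for three single nodes, whiskered. *)
Lemma swap_braid a l p q r m :
    tree a (l ++ p :: q :: r :: m) ->
    apart p.1 q.1 -> apart q.1 r.1 -> apart p.1 r.1 ->
  eqv a (l ++ p :: q :: r :: m) (l ++ r :: q :: p :: m)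
    (swap a (l ++ [:: r]) p q m \o swap a l p r (q :: m) \o
       swap a (l ++ [:: p]) q r m)%ar
    (swap a l q r (p :: m) \o swap a (l ++ [:: q]) p r m \o
       swap a l p q (r :: m))%ar.
Proof.
move=> fl pq qr pr; have [fl' lp lq _] := fits_swap fl pq.
have f1 : tree a ((l ++ [:: p]) ++ q :: r :: m) by rewrite -catA.
have [_ _ lpr fm] := fits_swap f1 qr; rewrite -catA /= in fm.
have fpqr : tree a (l ++ [:: p; q; r]).
  by move: fl; rewrite -[_ :: _]/([:: p; q; r] ++ m) catA => /fits_cat[].
have h1 : hom a (l ++ [:: p; q; r]) (l ++ [:: p; r; q])
    (swap a (l ++ [:: p]) q r [::]).
  by have := @hom_swap a (l ++ [:: p]) q r [::]; rewrite -!catA; apply.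
have [_ fprq E1] := hom_fits h1.
have h2 := hom_swap fprq pr; have [_ frpq _] := hom_fits h2.
have h3 : hom a (l ++ [:: r; p; q]) (l ++ [:: r; q; p])
    (swap a (l ++ [:: r]) p q [::]).
  by have := @hom_swap a (l ++ [:: r]) p q [::]; rewrite -!catA; apply.
have k1 := hom_swap fpqr pq; have [_ fqpr E2] := hom_fits k1.
have k2 : hom a (l ++ [:: q; p; r]) (l ++ [:: q; r; p])
    (swap a (l ++ [:: q]) p r [::]).
  by have := @hom_swap a (l ++ [:: q]) p r [::]; rewrite -!catA; apply.
have [_ fqrp _] := hom_fits k2; have k3 := hom_swap fqrp qr.
have e : eqv a (l ++ [:: p; q; r]) (l ++ [:: r; q; p])
    (swap a (l ++ [:: r]) p q [::] \o swap a l p r [:: q] \o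
       swap a (l ++ [:: p]) q r [::])%ar
    (swap a l q r [:: p] \o swap a (l ++ [:: q]) p r [::] \o
       swap a l p q [:: r])%ar.
  apply: eqv_ax.
  - exact: hom_comp h1 (hom_comp h2 h3).
  - exact: hom_comp k1 (hom_comp k2 k3).
  - rewrite /swap /whisker /= -(juxt_mk a l p.1 [:: p]) -(juxt_mk a l q.1 [:: q]).
    by rewrite -(juxt_mk a l r.1 [:: r]); apply: ax_theta_hexagon.
have := eqv_trans (whisker_comp3 h1 h2 h3 fm) 
  (eqv_trans (eqv_whisker e fm) (eqv_sym (whisker_comp3 k1 k2 k3 fm))).
by rewrite -!catA.
Qed.

Lemma cat_split (T : Type) (s1 s2 t1 t2 : seq T) : s1 ++ t1 = s2 ++ t2 ->
  size s1 <= size s2 -> exists2 t, s2 = s1 ++ t & t1 = t ++ t2.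
Proof.
elim: s1 s2 => [|x s1 IH] [|y s2] //=; try by exists [::].
- by move=> -> _; exists (y :: s2).
- by case=> -> /IH{}IH /IH[t -> ->]; exists t.
Qed.

Definition joins a l m1 u1 m2 u2 : Prop :=
  exists n v1 v2, [/\ descent a m1 n v1, descent a m2 n v2 &
    eqv a l n (v1 \o u1)%ar (v2 \o u2)%ar].

Lemma joins_sym a l m1 u1 m2 u2 : joins a l m1 u1 m2 u2 -> joins a l m2 u2 m1 u1.
Proof. by case=> n [v1 [v2 [s1 s2 /eqv_sym e]]]; exists n, v2, v1. Qed.

(** Local confluence. If the swaps overlap in a node, transitivity of the
    orientation lets the two outer nodes be exchanged as well, and both sides of
    [swap_braid] are composites of oriented swaps. *)
Lemma swaps_join a l l1 p q m1 l2 r s m2 : tree a l ->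
    l = l1 ++ p :: q :: m1 -> l = l2 ++ r :: s :: m2 ->
    right_of p.1 q.1 -> right_of r.1 s.1 ->
  joins a l (l1 ++ q :: p :: m1) (swap a l1 p q m1)
    (l2 ++ s :: r :: m2) (swap a l2 r s m2).
Proof.
wlog le12 : l1 p q m1 l2 r s m2 / size l1 <= size l2 => [hwlog|].
  move=> fl lE1 lE2 pq rs; case/orP: (leq_total (size l1) (size l2)) => le.
    exact: hwlog.
  by apply/joins_sym/hwlog.
move=> fl lE1; rewrite lE1 in fl *; move=> /cat_split - /(_ le12)[k -> E] pq rs.
have apq := right_apart pq; have ars := right_apart rs.
case: k E => [|p' [|q' k]] /= [].
- move=> ? ? ?; subst r s m2; rewrite cats0.
  have h := hom_swap fl apq; have [_ fl' _] := hom_fits h; have hid := hom_id fl'.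
  pose id1 := Id (mk a (l1 ++ q :: p :: m1)).
  exists (l1 ++ q :: p :: m1), id1, id1.
  split; [exact/swaps_id/eqv_refl|exact/swaps_id/eqv_refl|].
  exact/eqv_refl/(hom_comp h).
- move=> ? ? ?; subst p' r m1; rewrite -catA /=.
  have pr : right_of p.1 s.1 := left_of_trans rs pq; have apr := right_apart pr.
  have hp := hom_swap fl apq; have [_ fqps _] := hom_fits hp.
  have fl2 : tree a ((l1 ++ [:: p]) ++ q :: s :: m2) by rewrite -catA.
  have hq := hom_swap fl2 ars; have [_ fpsq _] := hom_fits hq.
  rewrite -!catA /= in fpsq hq.
  have fqps' : tree a ((l1 ++ [:: q]) ++ p :: s :: m2) by rewrite -catA.
  have d1 := descent_swap fqps' pr; have [_ fqsp _] := hom_fits (hom_swaps d1).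
  rewrite -!catA /= in d1 fqsp; have d2 := descent_swap fqsp rs.
  have d3 := descent_swap fpsq pr; have [_ fspq _] := hom_fits (hom_swaps d3).
  have fspq' : tree a ((l1 ++ [:: s]) ++ p :: q :: m2) by rewrite -catA.
  have d4 := descent_swap fspq' pq; rewrite -!catA /= in d4.
  exists (l1 ++ s :: q :: p :: m2), 
    (swap a l1 q s (p :: m2) \o swap a (l1 ++ [:: q]) p s m2)%ar,
    (swap a (l1 ++ [:: s]) p q m2 \o swap a l1 p s (q :: m2))%ar.
  split; [exact: swaps_comp d1 d2|exact: swaps_comp d3 d4|].
  exact/eqv_sym/swap_braid.
move=> ? ? ?; subst p' q' m1.
have e := swap_comm fl apq ars.
have [_ fl1 _] := hom_fits (hom_swap fl apq).
have fl2 : tree a ((l1 ++ q :: p :: k) ++ r :: s :: m2) by rewrite -catA.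
have fl3 : tree a ((l1 ++ p :: q :: k) ++ r :: s :: m2) by rewrite -catA.
have [_ fl4 _] := hom_fits (hom_swap fl3 ars).
have d1 := descent_swap fl2 rs; rewrite -!catA /= in d1 fl4 *.
have d2 := descent_swap fl4 pq.
by exists (l1 ++ q :: p :: k ++ s :: r :: m2), 
  (swap a (l1 ++ q :: p :: k) r s m2), (swap a l1 p q (k ++ s :: r :: m2)).
Qed.

Lemma descent_exists a l : tree a l ->
  exists m u, descent a l m u /\ sorted_nodes m.
Proof.
have [N] := ubnP (inversions l); elim: N l => // N IH l lN fl.
have [[k [p [q [m [lE pq]]]]]|no] :=
    EM (exists k p q m, l = k ++ p :: q :: m /\ right_of p.1 q.1); last first.
  exists l, (Id (mk a l)); split; first exact/swaps_id/eqv_refl/hom_id.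
  by move=> k p q m lE; apply/negP => pq; apply: no; exists k, p, q, m.
subst l; have d := descent_swap fl pq; have [_ fl' _] := hom_fits (hom_swaps d).
have [n [u [du sn]]] := IH _ (leq_trans (inversions_swap k m pq) lN) fl'.
by exists n, (u \o swap a k p q m)%ar; split=> //; apply: swaps_comp d du.
Qed.

Lemma descent_inv a l m u : descent a l m u ->
  (m = l /\ eqv a l l u (Id (mk a l))) \/
  exists k p q n v, [/\ l = k ++ p :: q :: n, right_of p.1 q.1,
    descent a (k ++ q :: p :: n) m v & eqv a l m u (v \o swap a k p q n)%ar].
Proof.
case=> {l m u} [l u uE|k p q n m v u fl _ pq dv uE]; first by left.
by right; exists k, p, q, n, v.
Qed.

(** Newman's argument, by induction on the number of inversions: when two
    descents start with different swaps, complete these to a commuting diagram,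
    descend from its corner to a sorted word, and compare the three descents by
    induction. *)
Lemma descent_unique a l m m' u u' : descent a l m u -> descent a l m' u' ->
  sorted_nodes m -> sorted_nodes m' -> m = m' /\ eqv a l m u u'.
Proof.
have [N] := ubnP (inversions l).
elim: N l m m' u u' => // N IH l m m' u u' lN d d' sm sm'.
have [[fl _] [fl' _]] := (hom_swaps d, hom_swaps d').
case: (descent_inv d) => [[? uE]|[k [p [q [n [v [lE pq dv uE]]]]]]];
  case: (descent_inv d') => [[? uE']|[k' [p' [q' [n' [v' [lE' pq' dv' uE']]]]]]].
- by subst m m'; split=> //; apply: eqv_trans uE (eqv_sym uE').
- by subst m; have := sm _ _ _ _ lE'; rewrite pq'.
- by subst m'; have := sm' _ _ _ _ lE; rewrite pq.
have [n0 [w [w' [dw dw' e]]]] := swaps_join fl lE lE' pq pq'.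
have [_ fn0 _] := hom_fits (hom_swaps dw).
have [n1 [c [dc sn1]]] := descent_exists fn0.
have lt : inversions (k ++ q :: p :: n) < N.
  by rewrite lE in lN; apply: leq_trans (inversions_swap k n pq) lN.
have lt' : inversions (k' ++ q' :: p' :: n') < N.
  by rewrite lE' in lN; apply: leq_trans (inversions_swap k' n' pq') lN.
have [mE vE] := IH _ _ _ _ _ lt dv (swaps_comp dw dc) sm sn1.
have [mE' vE'] := IH _ _ _ _ _ lt' dv' (swaps_comp dw' dc) sm' sn1.
subst m m'; split=> //.
have hc := hom_swaps dc; have hw := hom_swaps dw; have hw' := hom_swaps dw'.
have hs : hom a l (k ++ q :: p :: n) (swap a k p q n).
  by rewrite lE in fl *; apply: hom_swap fl (right_apart pq).
have hs' : hom a l (k' ++ q' :: p' :: n') (swap a k' p' q' n').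
  by rewrite lE' in fl *; apply: hom_swap fl (right_apart pq').
apply: eqv_trans uE _; apply: eqv_trans (eqv_comp (eqv_refl hs) vE) _.
apply: eqv_trans (eqv_sym (eqv_assoc hs hw hc)) _.
apply: eqv_trans (eqv_comp e (eqv_refl hc)) _.
apply: eqv_trans (eqv_assoc hs' hw' hc) _.
exact: eqv_trans (eqv_comp (eqv_refl hs') (eqv_sym vE')) (eqv_sym uE').
Qed.

(** A swap against the orientation is inverse to an oriented one, so it too
    commutes with the descents, by their uniqueness. *)
Lemma swaps_descent a l m u : all_swaps a l m u ->
  exists n (c d : arr), [/\ descent a l n c, descent a m n d, sorted_nodes n &
    eqv a l n (d \o u)%ar c].
Proof.
elim=> {l m u} [l u uE|l p q m n u v fl pq _ su [k [c [d [dc dd sk e]]]] vE].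
  have [[fl _] _ _] := uE; have [n [c [dc sn]]] := descent_exists fl.
  exists n, c, c; split=> //; have hc := hom_swaps dc.
  exact: eqv_trans (eqv_comp uE (eqv_refl hc)) (eqv_idr hc).
have hs := hom_swap fl pq; have [_ fl' _] := hom_fits hs.
have hu := hom_swaps su; have hd := hom_swaps dd.
have e' : eqv a (l ++ p :: q :: m) k (d \o v)%ar (c \o swap a l p q m)%ar.
  apply: eqv_trans (eqv_comp vE (eqv_refl hd)) _.
  apply: eqv_trans (eqv_assoc hs hu hd) _.
  exact: eqv_comp (eqv_refl hs) e.
case/orP: (pq) => [qp|pq'].
  have [k' [c' [dc' sk']]] := descent_exists fl.
  have ds' := descent_swap fl' qp; have hs' := hom_swaps ds'.
  have [? cE] := descent_unique dc (swaps_comp ds' dc') sk sk'; subst k'.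
  exists k, c', d; split=> //; apply: eqv_trans e' _.
  have hc' := hom_swaps dc'.
  apply: eqv_trans (eqv_comp (eqv_refl hs) cE) _.
  apply: eqv_trans (eqv_sym (eqv_assoc hs hs' hc')) _.
  exact: eqv_trans (eqv_comp (swap_inv fl pq) (eqv_refl hc')) (eqv_idr hc').
exists k, (c \o swap a l p q m)%ar, d; split=> //.
exact: swaps_comp (descent_swap fl pq') dc.
Qed.

Lemma swaps_parallel a l m u v : all_swaps a l m u -> all_swaps a l m v ->
  eqv a l m u v.
Proof.
move=> su sv; have [n [c [d [dc dd sn e]]]] := swaps_descent su.
have [n' [c' [d' [dc' dd' sn' e']]]] := swaps_descent sv.
have [? cE] := descent_unique dc dc' sn sn'; subst n'.
have [_ dE] := descent_unique dd dd' sn sn.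
have any := @swaps_sub _ any_pair a m n d (fun _ _ _ => isT) dd.
have [t st [td _]] := swaps_inv any.
have hu := hom_swaps su; have hv := hom_swaps sv; have hd := hom_swaps dd.
have ht := hom_swaps st.
have de : eqv a l n (d \o u)%ar (d \o v)%ar.
  apply: eqv_trans e (eqv_trans cE (eqv_trans (eqv_sym e') _)).
  exact: eqv_comp (eqv_refl hv) (eqv_sym dE).
have cancel (w : arr) : hom a l m w -> eqv a l m w (t \o (d \o w))%ar.
  move=> hw; apply: eqv_trans (eqv_sym (eqv_idl hw)) _.
  apply: eqv_trans (eqv_comp (eqv_refl hw) (eqv_sym td)) _.
  exact: (eqv_sym (eqv_assoc hw hd ht)).
apply: eqv_trans (cancel u hu) (eqv_trans _ (eqv_sym (cancel v hv))).
exact: eqv_comp de (eqv_refl ht).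
Qed.

End Coherence.

Theorem proposition18p1 (G : Type) (alpha : G -> nat) (u v : arr G) (f g : term G)
    (hu : arrow alpha u f g) (hv : arrow alpha v f g) :
  arr_eq alpha u v.
Proof.
have [a [l [m [fE gE su]]]] := arrow_swaps hu.
have [b [l' [m' [fE' gE' sv]]]] := arrow_swaps hv.
have [fl fm _] := hom_fits (hom_swaps su).
have [fl' fm' _] := hom_fits (hom_swaps sv).
have [? ?] := mk_inj fl fl' (etrans (esym fE) fE').
have [_ ?] := mk_inj fm fm' (etrans (esym gE) gE'); subst b l' m'.
by case: (swaps_parallel su sv).
Qed.
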